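(* Fix an integer $k\ge 2$ and positive integers $n,p_1,\ldots,p_k$ such that $\mathcal{M}^n_{p_1,\ldots,p_k}$ is nonempty. Consider the uniform distribution on pairs $B=((i_1,\ldots,i_{k-1}),(R_1,\ldots,R_n))$ such that $i_1,\ldots,i_{k-1}$ are integers in $[n]$ (repetitions allowed) and $(R_1,\ldots,R_n)\in\mathcal{M}^n_{p_1,\ldots,p_k}$. Then the probability that the graph $\alpha(B)$ is a tree is equal to the probability that the subset $R_1$ has cardinality $k-1$.
   Context: $[m]=\{1,\ldots,m\}$. $\mathcal{M}^n_{p_1,\ldots,p_k}$ is the set of $n$-tuples $(R_1,\ldots,R_n)$ of strict subsets of $[k]$ such that each $t\in[k]$ belongs to exactly $p_t$ of the subsets $R_1,\ldots,R_n$. For $t\in[k]$ and $R\subsetneq[k]$, the element $\alpha(t,R)\in[k]$ is defined, with all integers taken modulo $k$ (representatives in $[k]$), by: $\alpha(t,R)=t-1$ if $t\in R$; and $\alpha(t,R)=t+r$ if $t\notin R$, where $r\ge0$ is the integer such that $t+1,\ldots,t+r\in R$ and $t+r+1\notin R$. For $i_1,\ldots,i_{k-1}\in[n]$ and $R_1,\ldots,R_n\subsetneq[k]$, $\alpha((i_1,\ldots,i_{k-1}),(R_1,\ldots,R_n))$ is the undirected graph (loops and multiple edges allowed) with vertex set $[k]$ and $k-1$ edges $e_1,\ldots,e_{k-1}$, where $e_t=\{t,\alpha(t,R_{i_t})\}$. *)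

(* Defs.v *)
From mathcomp Require Import all_boot all_order all_algebra.

Set Implicit Arguments.
Unset Strict Implicit.
Unset Printing Implicit Defensive.

Section Multigraph.

Variables V E : finType.

(* Undirected multigraph: each edge has its set of endpoints, of cardinality 2,
   or 1 for a loop. *)
Definition multigraph := E -> {set V}.

Implicit Type G : multigraph.

Definition joins G (e : E) (x y : V) : bool := G e == [set x; y].

Definition adjacent G : rel V := fun x y => [exists e, joins G e x y].

Definition connected G : bool :=
  (0 < #|V|) && [forall x, forall y, connect (adjacent G) x y].

(* [:: (v_1, e_1); ...; (v_l, e_l)] stands for the closed walk
   v_1 e_1 v_2 ... v_l e_l v_1.  A loop is a cycle with l = 1, and two parallel
   edges form a cycle with l = 2. *)
Definition graph_cycle G (c : seq (V * E)) : bool :=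
  [&& 0 < size c, uniq (unzip1 c), uniq (unzip2 c)
    & cycle (fun a b => joins G a.2 a.1 b.1) c].

(* The bound on the length only serves to make acyclicity boolean: see
   acyclicP. *)
Definition acyclic G : bool :=
  [forall l : 'I_#|V|.+1, forall c : l.-tuple (V * E), ~~ graph_cycle G c].

Lemma acyclicP G : reflect (forall c, ~~ graph_cycle G c) (acyclic G).
Proof.
apply: (iffP idP) => [acG c|noc]; last by do 2!apply/forallP => ?.
apply/negP => cG; have /and4P[_ uV _ _] := cG.
have ltV : size c < #|V|.+1.
  by rewrite ltnS -(size_map fst) -(card_uniqP uV) max_card.
move/forallP/(_ (Ordinal ltV))/forallP/(_ (in_tuple c)): acG.
by rewrite cG.
Qed.

Definition is_tree G : bool := connected G && acyclic G.

End Multigraph.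

(* The element t of [k] is represented by t - 1 in 'I_k, so that ordS and
   ord_pred are the maps t |-> t + 1 and t |-> t - 1 modulo k. *)

Definition run k (t : 'I_k) (R : {set 'I_k}) : nat :=
  find (fun j => iter j.+1 (@ordS k) t \notin R) (iota 0 k).

Definition alpha k (t : 'I_k) (R : {set 'I_k}) : 'I_k :=
  if t \in R then ord_pred t else iter (run t R) (@ordS k) t.

Lemma val_iter_ordS k (t : 'I_k) j : iter j (@ordS k) t = (t + j) %% k :> nat.
Proof.
elim: j => [|j IHj]; first by rewrite addn0 modn_small.
by rewrite iterS /= IHj -addn1 modnDml addn1 addnS.
Qed.

Lemma runP k (t : 'I_k) (R : {set 'I_k}) r : t \notin R ->
  (forall j, 0 < j <= r -> iter j (@ordS k) t \in R) /\
    iter r.+1 (@ordS k) t \notin R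
  <-> r = run t R.
Proof.
move=> tR; pose a j := iter j.+1 (@ordS k) t \notin R.
have k_gt0 : 0 < k by exact: leq_ltn_trans (leq0n t) (ltn_ord t).
have itk : iter k (@ordS k) t = t.
  by apply: val_inj; rewrite /= val_iter_ordS modnDr modn_small.
have ha : has a (iota 0 k).
  apply/hasP; exists k.-1; first by rewrite mem_iota leq0n add0n ltn_predL.
  by rewrite /a prednK // itk.
have ltr : run t R < k by move: ha; rewrite has_find size_iota.
have stop : a (run t R).
  by have := nth_find 0 ha; rewrite nth_iota // add0n.
have before j : j < run t R -> ~~ a j.
  move=> ltj; have := before_find 0 ltj.
  by rewrite nth_iota ?add0n => [/negbT|]; last exact: ltn_trans ltr.
split=> [[inR outR]|->].
  case: (ltngtP r (run t R)) => // [/before/negP[]//|lt].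
  by have /negP[] := stop; apply: inR.
split=> // -[//|j] /before /negPn.
exact.
Qed.

(* Edges are indexed by 'I_k.-1: there is none for the last vertex. *)
Definition alpha_graph k n
    (B : {ffun 'I_k.-1 -> 'I_n} * {ffun 'I_n -> {set 'I_k}}) :
    multigraph 'I_k 'I_k.-1 :=
  fun s => let t := widen_ord (leq_pred k) s in [set t; alpha t (B.2 (B.1 s))].

Definition subset_tuples k n (p : 'I_k -> nat) :
    {set {ffun 'I_n -> {set 'I_k}}} :=
  [set R : {ffun 'I_n -> {set 'I_k}} |
     [forall i, R i \proper [set: 'I_k]]
       && [forall t, #|[set i | t \in R i]| == p t]].

Definition pairs k n (p : 'I_k -> nat) :
    {set {ffun 'I_k.-1 -> 'I_n} * {ffun 'I_n -> {set 'I_k}}} :=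
  setX [set: {ffun 'I_k.-1 -> 'I_n}] (subset_tuples n p).

(* Probability of the event A under the uniform distribution on the (nonempty)
   finite set S. *)
Definition uniform_prob (T : finType) (S : {set T}) (A : pred T) : rat :=
  (#|[set x in S | A x]|%:R / #|S|%:R)%R.

(* Main.v *)
Require Import Defs.
From mathcomp Require Import all_boot all_order all_algebra.
From mathcomp Require Import all_fingroup zify ring.

(** For every fixed (i_1, ..., i_{k-1}), the number of tuples R for which the
    graph is a tree does not depend on (i_1, ..., i_{k-1}); when all the i_t are
    equal to 1, the graph is a tree if and only if R_1 has cardinality k - 1,
    because alpha(., R_1) is a permutation with one cycle for each element of
    the complement of R_1.

    To change a single i_t from a to b, average over the exchanges of the
    memberships of R_a and R_b at an arbitrary set of positions, which preserve
    the p_t.  The indicator T of trees is the reduced determinant of I - A, where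
    A is the matrix of the map defining the edges, so that T is multilinear and
    alternating in the rows.  The only consequence needed is the relation
    T(s -> a, t -> a) - T(s -> b, t -> a) = T(s -> a, t -> b) - T(s -> b, t -> b).
    It allows an induction on the number of positions in exactly one of the two
    sets. *)

Set Implicit Arguments.
Unset Strict Implicit.
Unset Printing Implicit Defensive.

Import GRing.Theory Num.Theory.

(** * The next element in cyclic order *)

Section NextBlocker.

Variable k : nat.
Implicit Types (b : pred 'I_k) (s t x : 'I_k).

(** The search starts at [ordS s] and tests [s] last, so a run blocked only by [s] makes a full
    turn. For empty [b] the value is the default [ordS s]. *)
Definition nxt b s : 'I_k :=
  iter (find (fun j => b (iter j.+1 (@ordS k) s)) (iota 0 k)).+1 (@ordS k) s.

Lemma eq_nxt b b' s : b =1 b' -> nxt b s = nxt b' s.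
Proof.
move=> eb; rewrite /nxt.
have e : (fun j => b (iter j.+1 (@ordS k) s)) =1
         (fun j => b' (iter j.+1 (@ordS k) s)) by move=> j; exact: eb.
by rewrite (eq_find e).
Qed.

Lemma iter_ordS_reach s x : exists2 j, j < k & x = iter j.+1 (@ordS k) s.
Proof.
have k_gt0 : 0 < k := leq_ltn_trans (leq0n s) (ltn_ord s).
exists ((x + k - s.+1) %% k); first by rewrite ltn_mod.
apply: ord_inj; rewrite val_iter_ordS -addSnnS modnDmr.
have -> : s.+1 + (x + k - s.+1) = x + k.
  by rewrite subnKC // (leq_trans (ltn_ord s)) ?leq_addl.
by rewrite modnDr modn_small.
Qed.

Lemma nxtP b s x : b x ->
  exists r, [/\ r < k, nxt b s = iter r.+1 (@ordS k) s, b (nxt b s)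
             & forall j, j < r -> ~~ b (iter j.+1 (@ordS k) s)].
Proof.
move=> bx; have [i ltik xE] := iter_ordS_reach s x.
pose a j := b (iter j.+1 (@ordS k) s).
have ha : has a (iota 0 k).
  by apply/hasP; exists i; rewrite ?mem_iota // /a -xE.
have ltr : find a (iota 0 k) < k by move: ha; rewrite has_find size_iota.
exists (find a (iota 0 k)); split=> //.
  by have := nth_find 0 ha; rewrite nth_iota.
move=> j ltj; have := before_find 0 ltj.
by rewrite nth_iota ?add0n => [/negbT|]; last exact: ltn_trans ltr.
Qed.

Lemma nxt_mem b s x : b x -> b (nxt b s).
Proof. by move=> bx; have [r []] := nxtP s bx. Qed.

Lemma nxt_uniq b s r : b (iter r.+1 (@ordS k) s) ->
  (forall j, j < r -> ~~ b (iter j.+1 (@ordS k) s)) ->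
  nxt b s = iter r.+1 (@ordS k) s.
Proof.
move=> br before; have [r' [_ -> br' before']] := nxtP s br.
case: (ltngtP r r') => [/before'|/before|-> //]; first by rewrite br.
by rewrite br'.
Qed.

Lemma nxt_rec b s x : b x ->
  nxt b s = if b (ordS s) then ordS s else nxt b (ordS s).
Proof.
move=> bx; case: ifPn => [bS|nbS]; first by rewrite (@nxt_uniq _ _ 0).
have [[|r] [_ rE br before]] := nxtP s bx.
  by move: br; rewrite rE (negPf nbS).
rewrite rE iterSr; apply/esym/nxt_uniq; first by rewrite -iterSr -rE.
by move=> j ltj; rewrite -iterSr before.
Qed.

(** Induction along the run from [s]; it ends because [x] is met within [k] steps. *)
Lemma nxt_ind b x (P : 'I_k -> Prop) : b x ->
  (forall s, b (ordS s) -> P s) ->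
  (forall s, ~~ b (ordS s) -> P (ordS s) -> P s) ->
  forall s, P s.
Proof.
move=> bx Pb PS s; have [j _ xE] := iter_ordS_reach s x.
elim: j s xE => [|j IHj] s xE; first by apply: Pb; rewrite -[ordS s]xE.
have [/Pb//|nbS] := boolP (b (ordS s)).
by apply: PS => //; apply: IHj; rewrite xE iterSr.
Qed.

Lemma nxt_pred1 b s t : b =1 pred1 t -> nxt b s = t.
Proof.
move=> bE; have bt : b t by rewrite bE /= eqxx.
by have := nxt_mem s bt; rewrite bE => /eqP.
Qed.

Lemma nxtU b b' s :
  nxt (predU b b') s = nxt b s \/ nxt (predU b b') s = nxt b' s.
Proof.
have [x bx|b0] := pickP b.
  have [x' b'x|b'0] := pickP b'; last first.
    by left; apply: eq_nxt => y; rewrite /= b'0 orbF.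
  elim/(@nxt_ind (predU b b') x): s => [|s bS|s bS]; first by rewrite /= bx.
    have [] := orP bS => bS'; [left | right].
      by rewrite (@nxt_rec _ _ x) /= ?bx // (nxt_rec s bx) bS'.
    by rewrite (@nxt_rec _ _ x) /= ?bx // (nxt_rec s b'x) bS' orbT.
  move=> IH; rewrite (@nxt_rec _ _ x) ?[predU _ _ x]/= ?bx // (negPf bS).
  move: bS => /norP[/negPf bS /negPf b'S].
  by rewrite (nxt_rec s bx) (nxt_rec s b'x) bS b'S.
by right; apply: eq_nxt => y; rewrite /= b0.
Qed.

(** A run newly stopped at [t] used to pass through [t], and went on from there like the run from
    [t]. *)
Lemma nxt_predU1 b t s x : b x -> ~~ b t ->
  (nxt (predU1 t b) s = t /\ nxt b s = nxt b t) \/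
  (nxt (predU1 t b) s != t /\ nxt (predU1 t b) s = nxt b s).
Proof.
move=> bx nbt; have b1x : predU1 t b x by rewrite /= bx orbT.
elim/(@nxt_ind (predU1 t b) x): s => // s bS.
  rewrite (nxt_rec s b1x) bS (nxt_rec s bx).
  have [->|neq] := eqVneq (ordS s) t; [left | right; split=> //].
    by rewrite (negPf nbt).
  by move: bS; rewrite /= (negPf neq) /= => ->.
rewrite (nxt_rec s b1x) (negPf bS) (nxt_rec s bx).
by move: bS => /norP[_ /negPf->].
Qed.

Lemma nxt_predU1_id b t x : b x -> ~~ b t ->
  nxt (predU1 t b) t = nxt b t.
Proof.
move=> bx nbt; have [r [ltrk rE br before]] := nxtP t bx.
rewrite rE; apply: nxt_uniq => [|j ltjr]; first by rewrite -rE /= br orbT.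
rewrite /= negb_or before // andbT; apply/eqP => /(congr1 (@nat_of_ord k)) tE.
(* A return to [t] after [j.+1] steps would force [k] to divide [j.+1], but [j < r < k]. *)
have : t + j.+1 == t + 0 %[mod k].
  by rewrite -val_iter_ordS tE addn0 modn_small.
rewrite eqn_modDl mod0n => /dvdn_leq-/(_ isT); apply/negP.
by rewrite -ltnNge (leq_ltn_trans ltjr).
Qed.

End NextBlocker.

(** * Exchangeable functions and label independence *)

Section Update.

Local Open Scope ring_scope.

Variables (I : finType) (P : eqType).
Implicit Types (h : {ffun I -> P}) (v t : I).

Definition upd h v y : {ffun I -> P} := [ffun s => if s == v then y else h s].

Lemma updK h v y z : upd (upd h v y) v z = upd h v z.
Proof. by apply/ffunP => s; rewrite !ffunE; case: eqP. Qed.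

Lemma updC h v t y z : t != v -> upd (upd h v y) t z = upd (upd h t z) v y.
Proof.
by move=> neq; apply/ffunP => s; rewrite !ffunE; case: eqP => // ->; rewrite (negPf neq).
Qed.

Lemma upd_eq h v y : upd h v y v = y.
Proof. by rewrite ffunE eqxx. Qed.

Lemma upd_id h v : upd h v (h v) = h.
Proof. by apply/ffunP => s; rewrite ffunE; case: eqP => // ->. Qed.

(** The entries of [h] are replaced one at a time by those of [h']; [Q] describes the replacements
    allowed. *)
Lemma upd_invariant (V : Type) (G : {ffun I -> P} -> V) (Q : I -> P -> P -> Prop) :
  (forall h v y, Q v (h v) y -> G (upd h v y) = G h) ->
  forall h h', (forall v, h v = h' v \/ Q v (h v) (h' v)) -> G h = G h'.
Proof.
move=> GQ h h'; have [m] := ubnP #|[set v | h v != h' v]|.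
elim: m => // m IHm in h *; rewrite ltnS => le_m hQ.
have [v neq|eq] := pickP (fun v => h v != h' v); last first.
  by congr G; apply/ffunP => v; apply/eqP; rewrite -[_ == _]negbK eq.
have Qv : Q v (h v) (h' v) by case: (hQ v) neq => // ->; rewrite eqxx.
rewrite -(GQ _ _ _ Qv); apply: IHm => [|s]; last first.
  by rewrite ffunE; case: eqP => [->|_]; [left | apply: hQ].
apply: leq_trans le_m; apply: proper_card; apply/properP; split.
  by apply/subsetP => s; rewrite !inE ffunE; have [->|//] := eqVneq s v; rewrite eqxx.
by exists v; rewrite !inE ?ffunE ?eqxx.
Qed.

Definition exchangeable (T : {ffun I -> P} -> int) := forall h t v a b, t != v ->
  T (upd (upd h v a) t a) - T (upd (upd h v a) t b) =
  T (upd (upd h v b) t a) - T (upd (upd h v b) t b).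

(* Once row t is differenced between a and b, the other rows do not
   distinguish a from b. *)
Lemma exchangeable_sub T h h' t a b : exchangeable T ->
  (forall s, s != t ->
     h s = h' s \/ (h s \in [:: a; b]) && (h' s \in [:: a; b])) ->
  T (upd h t a) - T (upd h t b) = T (upd h' t a) - T (upd h' t b).
Proof.
move=> exT hh'.
pose Q v x y := (v == t) || (x \in [:: a; b]) && (y \in [:: a; b]).
apply: (@upd_invariant _ (fun h => T (upd h t a) - T (upd h t b)) Q); last first.
  move=> v; have [->|neq] := eqVneq v t; first by right; rewrite /Q eqxx.
  by case: (hh' _ neq) => [|hab]; [left | right; rewrite /Q hab orbT].
move=> {hh'}h v y; rewrite /Q; have [->|neq] := eqVneq v t; first by rewrite !updK.
have exh : forall x, x \in [:: a; b] ->
    T (upd (upd h v x) t a) - T (upd (upd h v x) t b) =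
    T (upd (upd h v a) t a) - T (upd (upd h v a) t b).
  move=> x; rewrite !inE => /orP[]/eqP-> //.
  by apply/esym/exT; rewrite eq_sym.
by case/andP=> /exh; rewrite upd_id => -> /exh->.
Qed.

End Update.

(** * Two sets averaged over exchanges: independence of the labels *)

Section LabelIndependence.

Local Open Scope ring_scope.

Variables (k : nat) (P : eqType) (T : {ffun 'I_k -> P} -> int).
Hypothesis exT : exchangeable T.

(* [M s l] means that s is not in the set with label l, so that s stops the runs
   of this set; [lab s] is the label of the set used by the edge of s, and [p s]
   generalizes the predecessor of s. *)
Implicit Types (M N : 'I_k -> bool -> bool) (lab X Y : {ffun 'I_k -> bool}).
Implicit Types (p : 'I_k -> P) (s t : 'I_k).

Definition target p M lab : {ffun 'I_k -> P} :=
  [ffun s => if M s (lab s) then p (nxt (M^~ (lab s)) s) else p s].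

Definition strict M := [forall l, exists s, M s l].

Definition swap X M s l := M s (l (+) X s).

(** An exchange can make one of the two sets full; such pairs weigh 0 because only strict subsets
    are counted. *)
Definition weight p M lab := if strict M then T (target p M lab) else 0.

Definition swap_total p M lab := \sum_X weight p (swap X M) lab.

Lemma eq_target p p' M N lab : p =1 p' -> M =2 N ->
  target p M lab = target p' N lab.
Proof.
move=> ep eM; apply/ffunP => s; rewrite !ffunE eM !ep.
by rewrite (@eq_nxt _ (M^~ _) (N^~ (lab s))).
Qed.

Lemma eq_strict M N : M =2 N -> strict M = strict N.
Proof. by move=> eM; apply: eq_forallb => l; apply: eq_existsb => s; apply: eM. Qed.

Lemma eq_weight p M N lab : M =2 N -> weight p M lab = weight p N lab.
Proof. by move=> eM; rewrite /weight (eq_strict eM) (@eq_target p p M N). Qed.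

(* The set with label l omits t if and only if [c l]. *)
Definition block (c : pred bool) t N s l := (s == t) && c l || N s l.

Lemma strict_block c t N : (forall l, exists s, N s l) -> strict (block c t N).
Proof.
by move=> N0; apply/forallP => l; apply/existsP; have [s sl] := N0 l; exists s;
  rewrite /block sl orbT.
Qed.

(** A new blocker at [t] affects only the runs that crossed [t]. Letting [p'] differ from [p] at [t]
    covers the redirected map as well as [p] itself. *)
Lemma target_block_off c t N p p' lab s : (forall l, ~~ N t l) ->
    (forall l, exists s, N s l) -> (forall s, s != t -> p' s = p s) ->
    s != t ->
  target p' (block c t N) lab s = target p N lab s \/
  [/\ c (lab s), target p' (block c t N) lab s = p' t &
      target p N lab s = p (nxt (N^~ (lab s)) t)].
Proof.
move=> Nt N0 pp' neq; rewrite !ffunE /block (negPf neq) /=.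
have [Ns|_] := ifP; last by left; apply: pp'.
have [x Nx] := N0 (lab s).
have [cl|ncl] := boolP (c (lab s)); last first.
  left; rewrite (@eq_nxt _ _ (N^~ (lab s))) => [|y]; last by rewrite andbF.
  rewrite pp' //; apply: contraTneq (@nxt_mem _ (N^~ (lab s)) s _ Nx) => ->; exact: Nt.
rewrite (@eq_nxt _ _ (predU1 t (N^~ (lab s)))) => [|y]; last by rewrite andbT.
have [[-> ->]|[neq' eq']] :=
  @nxt_predU1 _ (N^~ (lab s)) _ s _ Nx (Nt _); first by right.
by left; rewrite pp' // eq'.
Qed.

Lemma target_block_on c t N p lab x : (forall l, ~~ N t l) -> N x (lab t) ->
  target p (block c t N) lab t =
  if c (lab t) then p (nxt (N^~ (lab t)) t) else p t.
Proof.
move=> Nt Nx; rewrite !ffunE /block eqxx (negPf (Nt _)) orbF /=.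
case: ifP => // cl; rewrite (@eq_nxt _ _ (predU1 t (N^~ (lab t)))).
  by rewrite (@nxt_predU1_id _ (N^~ (lab t)) _ _ Nx).
by move=> y; rewrite /= cl andbT.
Qed.

(** With no other blocker, a run leaving [t] comes back to [t], with the same result as if [t] were
    in the set. *)
Lemma target_block_empty c t N p lab : (forall s, ~~ N s (lab t)) ->
  target p (block c t N) lab t = p t.
Proof.
move=> N0; rewrite !ffunE /block eqxx (negPf (N0 _)) orbF /=.
case: ifP => // cl; rewrite (@nxt_pred1 _ _ _ t) // => y.
by rewrite /= cl andbT (negPf (N0 _)) orbF.
Qed.

Lemma target_upd p M lab t l :
  target p M (upd lab t l) =
  upd (target p M lab) t (target p M (upd lab t l) t).
Proof.
by apply/ffunP => s; rewrite !ffunE eqxx; case: eqP => [->|].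
Qed.

Lemma weight_block_diff p N lab t c : (forall l, ~~ N t l) ->
    (forall l, exists s, N s l) ->
  let a := p (if c true then nxt (N^~ true) t else t) in
  let b := p (if c false then nxt (N^~ false) t else t) in
  weight p (block c t N) (upd lab t true) - weight p (block c t N) (upd lab t false)
  = T (upd (target p (block c t N) lab) t a) -
    T (upd (target p (block c t N) lab) t b).
Proof.
move=> Nt N0 a b; have [x Nx] := N0 true; have [y Ny] := N0 false.
rewrite /weight strict_block // target_upd (target_upd _ _ _ _ false).
rewrite (@target_block_on _ _ _ _ _ x) ?upd_eq //.
rewrite (@target_block_on _ _ _ _ _ y) ?upd_eq //.
by rewrite /a /b; case: (c true); case: (c false).
Qed.

(** Blocking at [t] alters another row only by trading one of the two values compared in row [t] for
    the other, so [exchangeable_sub] restores the rows [G] given by [N]. The left side telescopes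
    through the value [p t] to the difference between [n true] and [n false] in row [t]. Since [q]
    is one of these two values, the right side reduces to the same difference. *)
Lemma weight_exchange p N lab t : (forall l, ~~ N t l) ->
  let q := p (nxt (fun s => N s true || N s false) t) in
  let p' s := if s == t then q else p s in
  let Nz := block predT t N in
  weight p (block id t N) (upd lab t true) +
  weight p (block negb t N) (upd lab t true) -
  (weight p (block id t N) (upd lab t false) +
   weight p (block negb t N) (upd lab t false)) =
  T (target p' Nz (upd lab t true)) - T (target p' Nz (upd lab t false)).
Proof.
move=> Nt q p' Nz.
(* Degenerate case first: nothing but possibly [t] is missing from the set with label [l].
   Non-strict terms vanish, and in each other term row [t] is the same for both labels, so both
   sides are 0. *)
have [N0|] := boolP [forall l, exists s, N s l]; last first.
  rewrite negb_forall => /existsP[l]; rewrite negb_exists => /forallP Nl.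
  have strictF (c : pred bool) : ~~ c l -> strict (block c t N) = false.
    move=> ncl; apply/negP => /forallP/(_ l)/existsP[s].
    by rewrite /block (negPf ncl) andbF (negPf (Nl s)).
  have constE p1 M y : (forall m, target p1 M (upd lab t m) t = y) ->
      target p1 M (upd lab t true) = target p1 M (upd lab t false).
    by move=> ty; rewrite target_upd (target_upd _ _ _ _ false) !ty.
  have weightE (c : pred bool) : c (~~ l) = ~~ c l ->
      weight p (block c t N) (upd lab t true) = weight p (block c t N) (upd lab t false).
    move=> cNl; rewrite /weight; have [cl|/strictF->//] := boolP (c l).
    rewrite (@constE _ _ (p t)) // => m; have [->|neq] := eqVneq m l.
      by rewrite target_block_empty ?upd_eq // => s; apply: Nl.
    rewrite ffunE upd_eq /block eqxx (negPf (Nt _)) orbF /=.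
    have -> : m = ~~ l by move: neq; move: (l) (m) => [] [].
    by rewrite cNl cl.
  rewrite !weightE ?subrr; [| by case: (l)..].
  rewrite (@constE _ _ q) ?subrr // => m.
  have p't : p' t = q by rewrite /p' eqxx.
  have [->|neq] := eqVneq m l.
    by rewrite target_block_empty ?upd_eq // => s; apply: Nl.
  have mE s : N s true || N s false = N s m.
    by move: neq (Nl s); move: (l) (m) => [] [] // _ /negPf->; rewrite ?orbF.
  have [y Ny|N0] := pickP (N^~ m); last first.
    by rewrite target_block_empty ?upd_eq // => s; rewrite [N _ _]N0.
  rewrite (@target_block_on _ _ _ _ _ y) ?upd_eq //= /p' ifN.
    by rewrite /q; congr (p _); apply: eq_nxt => s; rewrite mE.
  by apply: contraTneq (@nxt_mem _ (N^~ m) t _ Ny) => ->; apply: Nt.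
have {}N0 l : exists s, N s l by apply/existsP/(forallP N0).
set G := target p N lab; pose n l := p (nxt (N^~ l) t).
have qn : q \in [:: n true; n false].
  have -> : q = p (nxt (predU (N^~ true) (N^~ false)) t).
    by congr (p _); apply: eq_nxt.
  by have [->|->] := nxtU (N^~ true) (N^~ false) t; rewrite !inE eqxx ?orbT.
have D1 := weight_block_diff p lab id Nt N0.
have D2 := weight_block_diff p lab negb Nt N0.
rewrite opprD addrACA D1 D2 /=.
rewrite (@exchangeable_sub _ _ _ _ G _ _ _ exT); last first.
  move=> s neq; have [->|[cs -> eq]] :=
    @target_block_off id t N p p lab s Nt N0 (fun _ _ => erefl) neq; first by left.
  by right; rewrite /G eq; case: (lab s) cs => // _; rewrite !inE !eqxx orbT.
rewrite (@exchangeable_sub _ _ _ _ G _ _ _ exT); last first.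
  move=> s neq; have [->|[cs -> eq]] :=
    @target_block_off negb t N p p lab s Nt N0 (fun _ _ => erefl) neq; first by left.
  by right; rewrite /G eq; case: (lab s) cs => // _; rewrite !inE !eqxx orbT.
rewrite addrA subrK.
have pp' s : s != t -> p' s = p s by rewrite /p' => /negPf->.
rewrite target_upd (target_upd _ _ _ _ false).
have [x Nx] := N0 true; have [y Ny] := N0 false.
rewrite (@target_block_on _ _ _ _ _ x) ?upd_eq //=.
rewrite (@target_block_on _ _ _ _ _ y) ?upd_eq //=.
rewrite !pp'; last 2 first.
- by apply: contraTneq (@nxt_mem _ (N^~ false) t _ Ny) => ->; apply: Nt.
- by apply: contraTneq (@nxt_mem _ (N^~ true) t _ Nx) => ->; apply: Nt.
apply: exchangeable_sub => // s neq.
have [->|[_ -> eq]] := @target_block_off predT t N p p' lab s Nt N0 pp' neq.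
  by left.
right; rewrite /G eq {1}/p' eqxx qn andbT.
by rewrite /n; case: (lab s); rewrite !inE eqxx ?orbT.
Qed.

Definition addf X Y : {ffun 'I_k -> bool} := [ffun s => X s (+) Y s].

Lemma swap_total_addf p M lab Y :
  swap_total p M lab = \sum_X weight p (swap (addf X Y) M) lab.
Proof.
rewrite /swap_total (reindex_inj (h := addf^~ Y)) // => X X' /ffunP eX.
by apply/ffunP => s; have := eX s; rewrite !ffunE => /addIb.
Qed.

Lemma strict_full M t : (forall l, M t l) -> strict M.
Proof. by move=> Mt; apply/forallP => l; apply/existsP; exists t. Qed.

(* Up to the exchange relations, adding the two positions of t and subtracting
   the two labels of t amounts to removing t from both sets, provided the runs
   that now stop at t are redirected to the next element missing from a set. *)
Lemma swap_total_split p M lab t : M t true != M t false ->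
  let q := p (nxt (fun s => (s != t) && (M s true || M s false)) t) in
  let p' s := if s == t then q else p s in
  let M' s l := (s == t) || M s l in
  (swap_total p M (upd lab t true) - swap_total p M (upd lab t false)) *+ 2 =
  swap_total p' M' (upd lab t true) - swap_total p' M' (upd lab t false).
Proof.
move=> Mt q p' M'.
(* Pairing [X] with its flip at [t] makes both positions of [t] appear in each summand; this is the
   source of the factor 2. *)
pose one : {ffun 'I_k -> bool} := [ffun s => s == t].
rewrite mulr2n {1}(swap_total_addf _ _ (upd lab t true) one).
rewrite {1}(swap_total_addf _ _ (upd lab t false) one).
rewrite addrACA -opprD -!big_split -!sumrB; apply: eq_bigr => X _ /=.
pose N s l := (s != t) && swap X M s l.
have Nt l : ~~ N t l by rewrite /N eqxx.
have qE : q = p (nxt (fun s => N s true || N s false) t).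
  congr (p _); apply: eq_nxt => s; rewrite /N /swap.
  by case: (s == t) => //=; case: (X s) => //=; rewrite orbC.
have M'E : swap X M' =2 block predT t N.
  move=> s l; rewrite /swap /M' /block /N andbT.
  by case: (s == t).
have stM' : strict (swap X M').
  by apply: (strict_full (t := t)) => l; rewrite /swap /M' eqxx.
rewrite {5}/weight {5}/weight stM'.
rewrite !(@eq_target p' p' _ _ _ (frefl _) M'E).
have := weight_exchange p lab Nt; rewrite -qE /= => <-.
have [e MtE] : exists e, forall l, M t l = l (+) e.
  by exists (M t false) => l; move: Mt; case: l; case: (M t true); case: (M t false).
have [Xt|Xt] := boolP (swap X M t true).
- have e1 : swap X M =2 block id t N.
    move=> s l; rewrite /block /N; have [->|] //= := eqVneq s t.
    by rewrite orbF; move: Xt; rewrite /swap !MtE; case: l; case: (X t); case: (e).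
  have e2 : swap (addf X one) M =2 block negb t N.
    move=> s l; rewrite /block /N /swap !ffunE; have [->|_] /= := eqVneq s t.
      by rewrite orbF; move: Xt; rewrite /swap !MtE; case: l; case: (X t); case: (e).
    by rewrite addbF.
  rewrite !(eq_weight _ _ e1) !(eq_weight _ _ e2).
  by congr (_ - _); apply: addrC.
- have e1 : swap X M =2 block negb t N.
    move=> s l; rewrite /block /N; have [->|] //= := eqVneq s t.
    by rewrite orbF; move: Xt; rewrite /swap !MtE; case: l; case: (X t); case: (e).
  have e2 : swap (addf X one) M =2 block id t N.
    move=> s l; rewrite /block /N /swap !ffunE; have [->|_] /= := eqVneq s t.
      by rewrite orbF; move: Xt; rewrite /swap !MtE; case: l; case: (X t); case: (e).
    by rewrite addbF.
  rewrite !(eq_weight _ _ e1) !(eq_weight _ _ e2).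
  by [].
Qed.

(** Runs never cross an element missing from both sets, and [Y] can change only there, so [Y] is
    constant along each run. Exchanging the sets on [Y] then amounts to flipping the labels on
    [Y]. *)
Lemma target_addf p M lab X Y t : (forall l, M t l) ->
    (forall s, ~~ (M (ordS s) true && M (ordS s) false) -> Y (ordS s) = Y s) ->
  target p (swap (addf X Y) M) lab = target p (swap X M) (addf lab Y).
Proof.
move=> Mt Ystep; apply/ffunP => s; rewrite !ffunE.
have swapE u l : swap (addf X Y) M u l = swap X M u (l (+) Y u).
  by rewrite /swap ffunE -addbA (addbC (Y u)).
have full u l : M u true && M u false -> swap X M u l.
  by case/andP=> M1 M2; rewrite /swap; case: (l (+) _).
rewrite swapE; case: ifP => // _; congr (p _).
pose b := (swap (addf X Y) M)^~ (lab s).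
have bt : b t by rewrite /b /swap Mt.
rewrite -[LHS]/(nxt b s); move: (lab s) @b bt => l b bt.
have bxt m : (swap X M)^~ m t by rewrite /swap Mt.
have step u : b (ordS u) = swap X M (ordS u) (l (+) Y u).
  have [Mu|/Ystep Yu] := boolP (M (ordS u) true && M (ordS u) false).
    by rewrite /b swapE !full.
  by rewrite /b swapE Yu.
elim/(@nxt_ind _ b t): s => // u.
  by rewrite (nxt_rec u bt) (nxt_rec u (bxt _)) -step => ->.
move=> bu IH; rewrite (nxt_rec u bt) (nxt_rec u (bxt _)) -step (negPf bu) IH.
rewrite Ystep //; apply: contra bu => Mu; rewrite step full //.
Qed.

(** Induction on the number of elements in exactly one set. At such an element, [swap_total_split]
    reduces a label change to a smaller instance. At an element of both sets, the target is the same
    for both labels. At an element missing from both, [target_addf] trades the change for changes of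
    the first two kinds. *)
Lemma swap_total_indep p M lab lab' : swap_total p M lab = swap_total p M lab'.
Proof.
have [m] := ubnP #|[set s | M s true != M s false]|.
elim: m => // m IHm in p M lab lab' *; rewrite ltnS => le_m.
have split_eq t L y : M t true != M t false ->
    swap_total p M (upd L t y) = swap_total p M L.
  move=> Mt.
  suff tf : swap_total p M (upd L t true) = swap_total p M (upd L t false).
    by rewrite -[in RHS](upd_id L t); case: y (L t) => [] [].
  apply/eqP; rewrite -subr_eq0.
  have /= <- := mulrn_eq0 (swap_total p M (upd L t true) -
                           swap_total p M (upd L t false)) 2.
  rewrite swap_total_split // subr_eq0; apply/eqP/IHm.
  apply: leq_trans le_m; apply: proper_card; apply/properP; split.
    by apply/subsetP => s; rewrite !inE; case: (s == t).
  by exists t; rewrite !inE ?eqxx.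
have free_eq (L L' : {ffun 'I_k -> bool}) :
    (forall s, L s = L' s \/ ~~ (M s true && M s false)) ->
    swap_total p M L = swap_total p M L'.
  move=> LL'.
  apply: (@upd_invariant _ _ _ (swap_total p M)
            (fun s _ _ => ~~ (M s true && M s false))) => //.
  move=> {LL'}L t y Mt; have [/split_eq//|] := boolP (M t true != M t false).
  rewrite negbK => /eqP Mtt; apply: eq_bigr => X _; congr (if _ then T _ else _).
  have Mt0 l : M t l = false.
    by move: Mt; rewrite -Mtt andbb => /negPf Mt; case: l; rewrite -?Mtt Mt.
  apply/ffunP => s; rewrite !ffunE; case: eqP => // ->.
  by rewrite /swap !Mt0.
apply: (@upd_invariant _ _ _ (swap_total p M) (fun _ _ _ => True)); last by right.
move=> L t y _.
have [Mt|] := boolP (M t true && M t false); last first.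
  move=> Mt; apply: free_eq => s; rewrite ffunE.
  by case: eqP => [->|_]; [right | left].
(* Exchanging the two sets on the run Y from t to the next element missing from
   both sets is the same as flipping the labels on Y. *)
pose e := [rel x u : 'I_k | (u == ordS x) && ~~ (M u true && M u false)].
pose Y : {ffun 'I_k -> bool} := [ffun s => connect e t s].
have Mtl l : M t l by case: l; case/andP: Mt.
have Ystep s : ~~ (M (ordS s) true && M (ordS s) false) -> Y (ordS s) = Y s.
  move=> Ms; rewrite !ffunE; apply/idP/idP => [/connectP[q]|ts]; last first.
    by apply: connect_trans ts _; apply: connect1; rewrite /= eqxx.
  case/lastP: q => [_ /= sE|q x]; first by rewrite sE Mt in Ms.
  rewrite rcons_path last_rcons => /andP[pq /andP[/eqP xE _]] sE.
  by apply/connectP; exists q => //; apply: (can_inj (@ordSK k)); rewrite sE.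
have Yt : Y t by rewrite ffunE connect0.
have YF s : s != t -> M s true && M s false -> Y s = false.
  move=> neq Ms; rewrite ffunE; apply/negP => /connectP[q].
  case/lastP: q => [_ /= sE|q x]; first by rewrite sE eqxx in neq.
  rewrite rcons_path last_rcons => /andP[_ /andP[_ nM]] sE.
  by rewrite -sE Ms in nM.
have [yE|neq] := eqVneq y (L t); first by rewrite yE upd_id.
rewrite (swap_total_addf _ _ (upd L t y) Y).
under eq_bigr => X _.
  rewrite /weight (strict_full (t := t)); last by move=> l; rewrite /swap Mtl.
  rewrite (target_addf _ _ _ Mtl Ystep).
  over.
transitivity (swap_total p M (addf (upd L t y) Y)).
  apply: eq_bigr => X _; rewrite /weight (strict_full (t := t)) // => l.
  by rewrite /swap Mtl.
(* Adding [Y] undoes the change at [t], and [Y] contains no other element missing from both sets. *)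
apply: free_eq => s; rewrite [addf _ _ s]ffunE [upd _ _ _ s]ffunE.
have [->|st] := eqVneq s t; first by left; rewrite Yt; case: y (L t) neq => [] [].
have [Ms|] := boolP (M s true && M s false); last by right.
by left; rewrite YF ?addbF.
Qed.

End LabelIndependence.

(** * Determinants and rooted trees *)

Section RowExchange.

Local Open Scope ring_scope.

Variables (n : nat) (A : 'M[int]_n) (s t : 'I_n).
Hypothesis neq_st : s != t.

Definition rows2 (x y : 'rV[int]_n) : 'M[int]_n :=
  \matrix_(i, j) if i == s then x 0 j else if i == t then y 0 j else A i j.

Lemma det_rows2Bl x x' y :
  \det (rows2 (x - x') y) = \det (rows2 x y) - \det (rows2 x' y).
Proof.
rewrite (@determinant_multilinear _ _ _ (rows2 x y) (rows2 x' y) s 1 (-1)).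
- by rewrite mul1r mulN1r.
- by apply/rowP => j; rewrite !mxE eqxx mul1r mulN1r.
- by apply/matrixP => i j; rewrite !mxE eq_sym (negPf (neq_lift _ _)).
- by apply/matrixP => i j; rewrite !mxE eq_sym (negPf (neq_lift _ _)).
Qed.

Lemma det_rows2Br x y y' :
  \det (rows2 x (y - y')) = \det (rows2 x y) - \det (rows2 x y').
Proof.
have ts : (t == s) = false by rewrite eq_sym (negPf neq_st).
rewrite (@determinant_multilinear _ _ _ (rows2 x y) (rows2 x y') t 1 (-1)).
- by rewrite mul1r mulN1r.
- by apply/rowP => j; rewrite !mxE ts eqxx mul1r mulN1r.
- apply/matrixP => i j; rewrite !mxE [_ == t]eq_sym (negPf (neq_lift _ _)).
  by [].
- apply/matrixP => i j; rewrite !mxE [_ == t]eq_sym (negPf (neq_lift _ _)).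
  by [].
Qed.

Lemma det_rows2xx x : \det (rows2 x x) = 0.
Proof.
apply: (determinant_alternate neq_st) => j.
by rewrite !mxE eqxx [t == s]eq_sym (negPf neq_st) eqxx.
Qed.

(** By bilinearity the mixed difference is a determinant in which both rows are [b - a]. *)
Lemma det_rows2_exchange x y a b :
  \det (rows2 (x - a) (y - a)) - \det (rows2 (x - b) (y - a)) =
  \det (rows2 (x - a) (y - b)) - \det (rows2 (x - b) (y - b)).
Proof.
apply/eqP; rewrite -!det_rows2Bl -subr_eq0 -det_rows2Br.
have -> : y - a - (y - b) = x - a - (x - b) by apply/matrixP => i j; rewrite !mxE; ring.
by rewrite det_rows2xx.
Qed.

End RowExchange.

(** * Functional graphs directed to a root *)

Section RootedTrees.

Local Open Scope ring_scope.

Variables (k : nat) (r : 'I_k).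
Hypothesis rE : r = k.-1 :> nat.
Notation w := (widen_ord (leq_pred k)).
Implicit Types (g : 'I_k.-1 -> 'I_k) (s : 'I_k.-1).

Definition step g : rel 'I_k := fun x y => [exists s, (x == w s) && (y == g s)].

Definition rooted g := [forall s, connect (step g) (w s) r].

(** The matrix [I - A] of the map [g], without the row and column of the root; its rows are indexed
    by the tails of the edges. *)
Definition tree_mx g : 'M[int]_k.-1 :=
  \matrix_(s, j) ((s == j)%:R - (w j == g s)%:R).

Lemma widen_neq_root s : w s != r.
Proof. by apply/eqP => /(congr1 val) /= e; have := ltn_ord s; rewrite e rE ltnn. Qed.

Lemma widen_inj : injective w.
Proof. by move=> s s' /(congr1 val) /= /ord_inj. Qed.

Lemma widenP x : x = r \/ exists s, x = w s.
Proof.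
have [xr|neq] := eqVneq (x : nat) k.-1.
  by left; apply: ord_inj; rewrite rE.
right; have ltx : (x < k.-1)%N by have := ltn_ord x; lia.
by exists (Ordinal ltx); apply: ord_inj.
Qed.

Lemma step_widen g s y : step g (w s) y = (y == g s).
Proof.
apply/existsP/idP => [[s' /andP[/eqP/widen_inj-> //]]|ys].
by exists s; rewrite eqxx.
Qed.

(** A walk that starts in [C] stays there, and the root is not of the form [w s]. *)
Lemma trapped g (C : {set 'I_k.-1}) : (forall s, s \in C -> g s \in w @: C) ->
  forall s, s \in C -> ~~ connect (step g) (w s) r.
Proof.
move=> gC s sC; apply/negP => /connectP[q].
elim: q s sC => [|y q IHq] s sC /=.
  by move=> _ /eqP; rewrite eq_sym (negPf (widen_neq_root s)).
rewrite step_widen => /andP[/eqP->].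
by have /imsetP[s' s'C ->] := gC s sC; apply: IHq.
Qed.

Lemma connect_step g s : connect (step g) (w s) r = connect (step g) (g s) r.
Proof.
apply/idP/idP => [/connectP[[_ /eqP|y q]]|].
- by rewrite eq_sym (negPf (widen_neq_root s)).
- rewrite /= step_widen => /andP[/eqP-> pq] rq.
  by apply/connectP; exists q.
by apply: connect_trans; apply: connect1; rewrite step_widen.
Qed.

(** A case of the matrix-tree theorem: with one edge leaving each other vertex, there is at most one
    spanning tree directed to the root. *)
Lemma det_tree_mx g : \det (tree_mx g) = (rooted g)%:R.
Proof.
have [/forallP gr|] := boolP (rooted g); last first.
  rewrite negb_forall => /existsP[s0 ns0]; apply/eqP; rewrite -det_tr.
  (* A vertex reaches the root exactly when its successor does, so the indicator of the vertices
     that do not is a kernel vector. *)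
  apply/det0P; exists (\row_s (~~ connect (step g) (w s) r)%:R).
    by apply/eqP => /rowP/(_ s0)/eqP; rewrite !mxE ns0 oner_eq0.
  apply/rowP => s; rewrite !mxE.
  under eq_bigr => j _ do rewrite !mxE mulrBr.
  rewrite sumrB (bigD1 s) //= eqxx mulr1 big1 ?addr0; last first.
    by move=> j /negPf neq; rewrite eq_sym neq mulr0.
  rewrite connect_step; have [->|[s' ->]] := widenP (g s).
    rewrite connect0 big1 ?subr0 // => j _.
    by rewrite (negPf (widen_neq_root _)) mulr0.
  rewrite (bigD1 s') //= eqxx mulr1 big1 ?addr0 ?subrr // => j neq.
  by rewrite (inj_eq widen_inj) (negPf neq) mulr0.
(* Only the identity contributes. Its diagonal entries are 1, since a loop would trap its vertex. *)
rewrite /determinant (bigD1 1%g) //= [X in _ + X]big1 ?addr0.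
  rewrite odd_perm1 expr0 mul1r big1 // => s _.
  rewrite !mxE perm1 eqxx; case: eqP => [ws|]; last by rewrite subr0.
  have := @trapped g [set s] _ s (set11 s); rewrite gr => /(_ _)/negP[] // s'.
  by move=> /set1P->; rewrite -ws; apply/imsetP; exists s; rewrite ?set11.
(* A nonzero term of a permutation f <> 1 would trap the support of f away from
   the root. *)
move=> f neq1; rewrite [X in _ * X](_ : _ = 0) ?mulr0 //.
apply/eqP; apply/prodf_eq0; apply/exists_inP; apply: contraT.
rewrite negb_exists_in => /forall_inP fnz.
pose C := [set i | f i != i].
have gC s : s \in C -> g s \in w @: C.
  rewrite inE => fs; have := fnz s isT.
  rewrite !mxE [s == _]eq_sym (negPf fs) sub0r oppr_eq0.
  case: (_ =P g s) => [<- _|//]; apply: imset_f.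
  by rewrite inE (inj_eq perm_inj).
have [s sC|C0] := pickP (mem C).
  by have := trapped gC sC; rewrite gr.
case/eqP: neq1; apply/permP => s; rewrite perm1; apply/eqP.
by have := C0 s; rewrite /= inE => /negbFE.
Qed.

(** Reaching the root is invariant along edges, so connectedness spreads it from [r] to all
    vertices. Conversely, the walks to the root connect the graph, and a cycle would be trapped. *)
Lemma is_treeE g : is_tree (fun s => [set w s; g s]) = rooted g.
Proof.
have neq_wr := widen_neq_root.
have adj_sym : symmetric (adjacent (fun s => [set w s; g s])).
  by move=> x y; apply: eq_existsb => s; rewrite /joins (setUC [set x]).
apply/idP/idP => [/andP[/andP[_ /forallP conn] _]|/forallP gr].
  pose a : pred 'I_k := fun x => connect (step g) x r.
  have cl : closed (adjacent (fun s => [set w s; g s])) a.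
    suff adj x y : adjacent (fun s => [set w s; g s]) x y -> a x -> a y.
      move=> x y xy; rewrite -!topredE /=; apply/idP/idP; apply: adj => //.
      by rewrite adj_sym.
    case/existsP=> s /eqP/setP e; rewrite /a.
    have := e x; have := e y; rewrite !inE !eqxx orbT /=.
    by do 2![case/orP=> /eqP->]; rewrite // ?connect_step.
  apply/forallP => s; have := closed_connect cl (forallP (conn r) (w s)).
  by rewrite -!topredE /= /a connect0 => <-.
apply/andP; split.
  apply/andP; split; first by apply/card_gt0P; exists r.
  have to_r x : connect (adjacent (fun s => [set w s; g s])) x r.
    have : connect (step g) x r by have [->|[s ->]] := widenP x.
    apply: connect_sub => {}x y /existsP[s /andP[/eqP-> /eqP->]].
    by apply/connect1/existsP; exists s; apply: eqxx.
  apply/forallP => x; apply/forallP => y; apply: connect_trans (to_r x) _.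
  by rewrite (sym_connect_sym adj_sym).
apply/acyclicP => c; apply/negP => /and4P[c0 uV uE cyc].
(* The cycle has as many vertices as edges, and the edges have distinct tails, so
   that its vertices are the tails of its edges and are trapped. *)
pose V := [set x in unzip1 c]; pose C := [set s in unzip2 c].
have ends x s : (x, s) \in c -> (w s \in V) && (g s \in V).
  move=> xs; have := next_cycle cyc xs; rewrite /joins /= => /eqP/setP e.
  have VE : [set x; (next c (x, s)).1] \subset V.
    apply/subsetP => y; rewrite !inE => /orP[]/eqP->.
      by apply/mapP; exists (x, s).
    by apply/mapP; exists (next c (x, s)); rewrite ?mem_next.
  by rewrite !(subsetP VE) -?e ?inE ?eqxx ?orbT.
have endsC s : s \in C -> (w s \in V) && (g s \in V).
  by rewrite inE => /mapP[[x s'] xs ->]; apply: ends xs.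
have VC : w @: C = V.
  apply/eqP; rewrite eqEcard; apply/andP; split.
    by apply/subsetP => _ /imsetP[s /endsC/andP[wV _] ->].
  rewrite card_imset; last exact: widen_inj.
  by rewrite !cardsE (card_uniqP uV) (card_uniqP uE) !size_map.
have gC s : s \in C -> g s \in w @: C by rewrite VC => /endsC/andP[].
case: c c0 @V @C {uV uE cyc ends endsC VC} gC => // [[x s] c] _ V C gC.
by have := @trapped g C gC s; rewrite gr inE mem_head => /(_ isT).
Qed.

Lemma eq_rooted g g' : g =1 g' -> rooted g = rooted g'.
Proof.
move=> eg; apply: eq_forallb => s; apply: eq_connect => x y.
by apply: eq_existsb => s'; rewrite eg.
Qed.

(** Free edges read their head from [h]. If [t] or [v] is the tail of no free edge, that entry of
    [h] is ignored; otherwise the two entries give two rows of [tree_mx], and [det_rows2_exchange]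
    applies. *)
Lemma rooted_exchangeable (free : pred 'I_k.-1) (c : 'I_k.-1 -> 'I_k) :
  exchangeable (fun h : {ffun 'I_k -> 'I_k} =>
    (rooted (fun s => if free s then h (w s) else c s))%:R).
Proof.
move=> h t v a b neq.
have irrelevant x h1 y : (forall s, free s -> w s != x) ->
    rooted (fun s => if free s then upd h1 x y (w s) else c s) =
    rooted (fun s => if free s then h1 (w s) else c s).
  by move=> nx; apply: eq_rooted => s; case: ifP => // /nx/negPf ws; rewrite ffunE ws.
have [s /andP[fs /eqP st]|nt] := pickP (fun s => free s && (w s == t)); last first.
  have nt' s1 : free s1 -> w s1 != t by move=> f1; have := nt s1; rewrite f1 => /negbT.
  rewrite (irrelevant t _ a nt') (irrelevant t _ b nt').
  rewrite (irrelevant t _ a nt') (irrelevant t _ b nt').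
  exact: etrans (subrr _) (esym (subrr _)).
have [s' /andP[fs' /eqP sv]|nv] := pickP (fun s => free s && (w s == v)); last first.
  have nv' s1 : free s1 -> w s1 != v by move=> f1; have := nv s1; rewrite f1 => /negbT.
  rewrite !(updC _ _ _ neq).
  rewrite (irrelevant v (upd h t a) a nv') (irrelevant v (upd h t b) a nv').
  by rewrite (irrelevant v (upd h t a) b nv') (irrelevant v (upd h t b) b nv').
have neq' : s != s' by apply: contraNneq neq => ss; rewrite -st -sv ss.
pose A := tree_mx (fun s => if free s then h (w s) else c s).
pose e s : 'rV[int]_k.-1 := \row_j (s == j)%:R.
pose d x : 'rV[int]_k.-1 := \row_j (w j == x)%:R.
have mxE2 x y : tree_mx (fun s => if free s then upd (upd h v y) t x (w s) else c s) =
    rows2 A s s' (e s - d x) (e s' - d y).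
  apply/matrixP => i j; rewrite !mxE; have [->|ns] := eqVneq i s.
    by rewrite fs !ffunE st !eqxx.
  have [->|ns'] := eqVneq i s'.
    by rewrite fs' !ffunE sv !eqxx [v == t]eq_sym (negPf neq).
  case: ifP => // _; rewrite !ffunE -st -sv !(inj_eq widen_inj).
  by rewrite (negPf ns) (negPf ns').
have detE x y :
    (rooted (fun s => if free s then upd (upd h v y) t x (w s) else c s))%:R =
    \det (rows2 A s s' (e s - d x) (e s' - d y)).
  by rewrite -mxE2 det_tree_mx.
have := det_rows2_exchange A neq' (e s) (e s') (d a) (d b).
by rewrite -(detE a a) -(detE b a) -(detE a b) -(detE b b).
Qed.

End RootedTrees.

(** * Counting trees *)

(** A run in [R] ends just before the next element missing from [R], so both cases become
    predecessors. *)
Lemma alphaE k (t : 'I_k) (R : {set 'I_k}) :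
  alpha t R = ord_pred (if t \in R then t else nxt (fun s => s \notin R) t).
Proof. by rewrite /alpha; case: ifP => // _; rewrite /nxt iterS ordSK. Qed.

Lemma properTE (T : finType) (S : {set T}) :
  (S \proper [set: T]) = [exists s, s \notin S].
Proof.
apply/properP/existsP => [[_ [s _ ns]]|[s ns]]; first by exists s.
by split; [exact: subsetT | exists s].
Qed.

(** * All edges governed by one set *)

Section SingleSet.

Variables (k : nat) (r : 'I_k).
Hypothesis rE : r = k.-1 :> nat.
Notation w := (widen_ord (leq_pred k)).

Lemma val_ord_pred (u : 'I_k) : (0 < u) -> ord_pred u = u.-1 :> nat.
Proof.
case: u => [[|u] ltu] // _; rewrite /= modnDr modn_small //.
exact: ltnW.
Qed.

Lemma nxt_between (b : pred 'I_k) (x d : 'I_k) : b d -> (x < d) ->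
  (x < nxt b x <= d).
Proof.
move=> bd; have [m] := ubnP (d - x); elim: m x => // m IHm x le_m ltxd.
have SxE : ordS x = x.+1 :> nat by rewrite /= modn_small //; have := ltn_ord d; lia.
rewrite (nxt_rec x bd); case: ifPn => [_|nb]; first by lia.
have neq : (ordS x != d :> nat) by apply: contraNneq nb => /ord_inj->.
have /andP[] := IHm (ordS x) ltac:(lia) ltac:(lia); lia.
Qed.

(** If one element is missing, [alpha] is the predecessor map, which leads down to 0 and then to the
    root. If [x < y] are both missing, the interval from [x] to [y - 1] is trapped. *)
Lemma rooted_alpha (S : {set 'I_k}) : S \proper [set: 'I_k] ->
  rooted r (fun s => alpha (w s) S) = (#|S| == k.-1).
Proof.
rewrite properTE => /existsP[c cS].
have k_gt0 : (0 < k) := leq_ltn_trans (leq0n c) (ltn_ord c).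
have cardS : (#|S| + #|~: S| = k) by rewrite cardsC card_ord.
have [S1|S1] := boolP (#|~: S| == 1).
  have -> : (#|S| == k.-1) = true by move/eqP: S1; lia.
  have notS x : (x \notin S) = (x == c).
    have /cards1P[y SE] := S1.
    by rewrite -!in_setC in cS *; move: cS; rewrite SE !inE => /eqP->.
  have alpha_pred x : alpha x S = ord_pred x.
    rewrite alphaE; case: ifPn => //; rewrite notS => /eqP->.
    by rewrite (@nxt_pred1 _ _ _ c).
  apply/forallP => s; have [m] := ubnP s; elim: m s => // m IHm s lt_m.
  rewrite connect_step // alpha_pred; have [->|[s' s'E]] := widenP rE (ord_pred (w s)).
    exact: connect0.
  rewrite s'E; apply: IHm; move/(congr1 (@nat_of_ord k)): s'E.
  (* The predecessor of 0 is the root, hence not of the form [w s']. *)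
  case: (posnP s) => [s0|s_gt0]; last first.
    by rewrite val_ord_pred //= => <-; rewrite prednK.
  rewrite /= s0 add0n modn_small ?ltn_predL // => e.
  by have := ltn_ord s'; rewrite -e ltnn.
have -> : (#|S| == k.-1) = false by apply/negbTE; move/eqP: S1; have := ltn_ord c; lia.
have : (1 < #|~: S|).
  by rewrite ltn_neqAle eq_sym S1 /=; apply/card_gt0P; exists c; rewrite inE.
case/card_gt1P => x [y [xS yS neq]].
wlog ltxy : x y xS yS neq / (x < y).
  move=> IH; have [|ltyx|/ord_inj xy] := ltngtP x y; first exact: IH.
    by apply: (IH y x) => //; rewrite eq_sym.
  by rewrite xy eqxx in neq.
rewrite !inE in xS yS.
pose C := [set s : 'I_k.-1 | (x <= s < y)].
have ltx : (x < k.-1) by have := ltn_ord y; lia.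
have gC s : s \in C -> alpha (w s) S \in w @: C.
  rewrite inE => lts.
  suff lta : (x <= alpha (w s) S < y).
    have lta' : (alpha (w s) S < k.-1) by have := ltn_ord y; lia.
    apply/imsetP; exists (Ordinal lta'); first by rewrite inE.
    exact: ord_inj.
  rewrite alphaE; case: ifPn => [wS|_].
    have neqx : x != s :> nat.
      by apply: contraNneq xS => e; rewrite (_ : x = w s) //; apply: ord_inj.
    by rewrite val_ord_pred /=; lia.
  have := @nxt_between (fun s => s \notin S) (w s) y yS.
  case/andP: lts => lexs ltsy; case/(_ ltsy)/andP => lt1 lt2.
  move: (nxt _ _) lt1 lt2 => u lt1 lt2; have {}lt1 : (s < u) := lt1.
  have {}lexs : (x <= s) := lexs.
  by rewrite val_ord_pred; lia.
apply/negbTE; rewrite negb_forall; apply/existsP; exists (Ordinal ltx).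
by apply: (@trapped _ r rE _ C gC); rewrite inE /=; lia.
Qed.

End SingleSet.

(** * Exchanging two sets of a tuple *)

Section SubsetTuples.

Local Open Scope ring_scope.

Variables (k n : nat) (r : 'I_k) (p : 'I_k -> nat).
Hypothesis rE : r = k.-1 :> nat.
Notation w := (widen_ord (leq_pred k)).
Implicit Types (R : {ffun 'I_n -> {set 'I_k}}) (X lab : {ffun 'I_k -> bool}).
Implicit Types (f : {ffun 'I_k.-1 -> 'I_n}) (a b i : 'I_n).

Definition edge_ends f R : 'I_k.-1 -> 'I_k := fun s => alpha (w s) (R (f s)).

Definition tree_count f : nat :=
  #|[set R in subset_tuples n p | rooted r (edge_ends f R)]|.

Definition swap_sets a b X R : {ffun 'I_n -> {set 'I_k}} :=
  [ffun i => [set s | s \in R (if X s then tperm a b i else i)]].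

Lemma swap_setsK a b X : involutive (swap_sets a b X).
Proof.
move=> R; apply/ffunP => i; apply/setP => s; rewrite !ffunE !inE !ffunE !inE.
by case: (X s); rewrite ?tpermK.
Qed.

(** The two conditions of [subset_tuples] are separated because exchanges preserve the marginals but
    not strictness. *)
Definition all_strict R := [forall i, R i \proper [set: 'I_k]].

Definition has_marginals R := [forall t, #|[set i | t \in R i]| == p t].

Lemma has_marginals_swap a b X R :
  has_marginals (swap_sets a b X R) = has_marginals R.
Proof.
apply: eq_forallb => t; congr (_ == _); have [Xt|Xt] := boolP (X t); last first.
  by apply: eq_card => i; rewrite !inE ffunE inE (negPf Xt).
rewrite -(card_imset _ (@perm_inj _ (tperm a b))); apply: eq_card => i.
rewrite !inE; apply/imsetP/idP => [[j]|tRi].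
  by rewrite inE ffunE inE Xt => tR ->.
by exists (tperm a b i); rewrite ?tpermK // inE ffunE inE Xt tpermK.
Qed.

Section TwoSets.

Variables (a b : 'I_n) (R : {ffun 'I_n -> {set 'I_k}}).
Hypothesis neq_ab : a != b.

Definition omits (s : 'I_k) (l : bool) := s \notin R (if l then b else a).

Lemma swap_sets_omits X s l :
  (s \notin swap_sets a b X R (if l then b else a)) = swap X omits s l.
Proof.
rewrite ffunE inE /swap /omits; case: (X s); rewrite ?addbF // addbT.
by case: l; rewrite ?tpermL ?tpermR.
Qed.

Lemma swap_sets_other X i : i != a -> i != b -> swap_sets a b X R i = R i.
Proof.
move=> na nb; apply/setP => s; rewrite ffunE inE.
by case: (X s) => //; rewrite tpermD // eq_sym.
Qed.

Lemma all_strict_swap X : all_strict (swap_sets a b X R) =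
  [forall (i | (i != a) && (i != b)), R i \proper [set: 'I_k]] &&
  strict (swap X omits).
Proof.
apply/forallP/andP => [sR|[/forall_inP oR /forallP sR] i].
  split; first by apply/forall_inP => i /andP[na nb]; rewrite -(swap_sets_other X na nb).
  apply/forallP => l; have := sR (if l then b else a); rewrite properTE.
  by congr is_true; apply: eq_existsb => s; apply: swap_sets_omits.
have lE l : swap_sets a b X R (if l then b else a) \proper [set: 'I_k].
  rewrite properTE; have := sR l.
  by congr is_true; apply: eq_existsb => s; rewrite swap_sets_omits.
have [->|na] := eqVneq i a; first exact: (lE false).
have [->|nb] := eqVneq i b; first exact: (lE true).
by rewrite swap_sets_other // oR // na.
Qed.

(** The edges using [a] or [b] are the free ones, labelled by which of the two they use; the other
    heads do not depend on [X]. Only the labels distinguish [f] from [f'], so [swap_total_indep]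
    applies. *)
Lemma rooted_swap_total f f' :
    (forall s, (f s == a) || (f s == b) = (f' s == a) || (f' s == b)) ->
    (forall s, (f s != a) && (f s != b) -> f s = f' s) ->
  \sum_(X : {ffun 'I_k -> bool} | all_strict (swap_sets a b X R))
     (rooted r (edge_ends f (swap_sets a b X R)))%:R =
  \sum_(X : {ffun 'I_k -> bool} | all_strict (swap_sets a b X R))
     (rooted r (edge_ends f' (swap_sets a b X R)))%:R :> int.
Proof.
move=> ff' fE.
pose free s := (f s == a) || (f s == b).
pose T (h : {ffun 'I_k -> 'I_k}) : int :=
  (rooted r (fun s => if free s then h (w s) else alpha (w s) (R (f s))))%:R.
have exT : exchangeable T by apply: rooted_exchangeable.
pose labels (g : {ffun 'I_k.-1 -> 'I_n}) : {ffun 'I_k -> bool} :=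
  [ffun x => [exists s, (w s == x) && (g s == b)]].
have [oR|noR] :=
  boolP [forall (i | (i != a) && (i != b)), R i \proper [set: 'I_k]]; last first.
  by rewrite !big_pred0 // => X; rewrite all_strict_swap (negPf noR).
have totalE (g : {ffun 'I_k.-1 -> 'I_n}) :
    (forall s, free s = (g s == a) || (g s == b)) ->
    (forall s, ~~ free s -> g s = f s) ->
    \sum_(X : {ffun 'I_k -> bool} | all_strict (swap_sets a b X R))
     (rooted r (edge_ends g (swap_sets a b X R)))%:R =
    swap_total T (@ord_pred k) omits (labels g).
  move=> freeE gE; rewrite big_mkcond; apply: eq_bigr => X _.
  rewrite all_strict_swap oR /= /weight; case: ifP => // _.
  congr (_ %:R); congr nat_of_bool; apply: eq_rooted => s; rewrite /edge_ends.
  case: ifPn => [fs|nfs]; last first.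
    by have := nfs; rewrite freeE negb_or gE // => /andP[? ?]; rewrite swap_sets_other.
  have lE : labels g (w s) = (g s == b).
    rewrite ffunE; apply/existsP/idP => [[s' /andP[/eqP/widen_inj->]]//|gb].
    by exists s; rewrite eqxx.
  have gsE : g s = if g s == b then b else a.
    by have := fs; rewrite freeE; case: eqP => [->|_]; case: eqP.
  rewrite [RHS]ffunE lE alphaE; move: gsE; move: (g s == b) => l ->.
  rewrite -swap_sets_omits if_neg; case: (w s \in _) => //.
  congr ord_pred.
  by apply: eq_nxt => x; rewrite swap_sets_omits.
have totalf := totalE f (fun _ => erefl) (fun _ _ => erefl).
have fE' s : ~~ free s -> f' s = f s by rewrite negb_or => /fE.
have totalf' := totalE f' ff' fE'.
apply: etrans totalf (etrans _ (esym totalf')).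
exact: swap_total_indep.
Qed.

End TwoSets.

(** For each [X] the exchange is an involution on the tuples with the given marginals, so reindexing
    by it preserves the count; strictness is tested after the exchange. *)
Lemma tree_count_sum f a b : (tree_count f)%:R *+ #|{ffun 'I_k -> bool}| =
  \sum_(R | has_marginals R)
    \sum_(X : {ffun 'I_k -> bool} | all_strict (swap_sets a b X R))
     (rooted r (edge_ends f (swap_sets a b X R)))%:R :> int.
Proof.
rewrite (exchange_big_dep xpredT) //= -sumr_const; apply: eq_bigr => X _.
rewrite /tree_count -sum1dep_card natr_sum.
rewrite (reindex_inj (inv_inj (swap_setsK a b X))) /=.
rewrite big_mkcond [RHS]big_mkcond; apply: eq_bigr => R _.
rewrite inE -/(all_strict _) -/(has_marginals _) has_marginals_swap.
by case: (all_strict _); case: (has_marginals R); case: (rooted r _).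
Qed.

Lemma tree_count_const f f' : tree_count f = tree_count f'.
Proof.
apply: (@upd_invariant _ _ _ tree_count (fun _ _ _ => True)); last by right.
move=> {f'}f t b _; have [->|neq] := eqVneq b (f t); first by rewrite upd_id.
suff: (tree_count (upd f t b))%:R *+ #|{ffun 'I_k -> bool}| =
      (tree_count f)%:R *+ #|{ffun 'I_k -> bool}| :> int.
  move/eqP; rewrite eqr_pMn2r ?eqr_nat => [/eqP//|].
  by apply/card_gt0P; exists [ffun=> true].
rewrite !(tree_count_sum _ (f t) b); apply: eq_bigr => R _.
rewrite eq_sym in neq; apply: rooted_swap_total => // s; rewrite ffunE;
  have [->|//] := eqVneq s t; rewrite ?eqxx ?orbT //.
by rewrite andbF.
Qed.

Lemma tree_count_card f j : tree_count f =
  #|[set R in subset_tuples n p | #|R j| == k.-1]|.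
Proof.
rewrite (tree_count_const f [ffun=> j]); apply: eq_card => R.
rewrite [LHS]inE [RHS]inE; have [RM /=|//] := boolP (R \in _).
have sR : forall i, R i \proper [set: 'I_k].
  by apply/forallP; move: RM; rewrite inE => /andP[].
rewrite -(rooted_alpha rE (sR j)); apply: eq_rooted => s.
by rewrite /edge_ends ffunE.
Qed.

End SubsetTuples.

Lemma card_pair_set (A B : finType) (Q : pred (A * B)) :
  #|[set x | Q x]| = \sum_a #|[set b | Q (a, b)]|.
Proof.
rewrite -sum1dep_card (eq_bigl (fun x => xpredT x.1 && Q (x.1, x.2))); last by case.
rewrite -(pair_big_dep xpredT (fun a b => Q (a, b)) (fun _ _ => 1)) /=.
by apply: eq_bigr => a _; rewrite sum1dep_card.
Qed.

Theorem theorem1p6 (k n : nat) (p : 'I_k -> nat) (hk : 2 <= k) (hn : 0 < n)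
    (hp : forall t : 'I_k, 0 < p t) (hM : subset_tuples n p != set0) :
  uniform_prob (pairs n p) (fun B => is_tree (alpha_graph B)) =
  uniform_prob (pairs n p) (fun B => #|B.2 (Ordinal hn)| == k - 1).
Proof.
have ltr : k.-1 < k by rewrite ltn_predL ltnW.
pose r := Ordinal ltr; have rE : r = k.-1 :> nat by [].
rewrite /uniform_prob; congr (_%:R / _)%R; rewrite !card_pair_set.
(* The equality holds separately for each choice [f] of the indices. *)
apply: eq_bigr => f _.
transitivity (tree_count r p f).
  apply: eq_card => R; rewrite !inE /= -(is_treeE rE); congr (_ && _).
rewrite (tree_count_card p rE f (Ordinal hn)); apply: eq_card => R.
by rewrite !inE /= subn1.
Qed.
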